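(* Let $Z,\tilde Z:[0,1]\to\mathbb R^d$ be absolutely continuous paths such that $\mathbf c_{\le2}(Z)$ and $\mathbf c_{\le2}(\tilde Z)$ lie in $\mathcal U_{d;\le 2}$. Define $Y=\tilde\rho_d(\mathbf c_{\le2}(Z))\,Z$ and $\tilde Y=\tilde\rho_d(\mathbf c_{\le2}(\tilde Z))\,\tilde Z$. Then $S(Y)=S(\tilde Y)$ if and only if there exists $g\in O_d(\mathbb R)$ such that $S(gZ)=S(\tilde Z)$.
   Context: Fix $d\ge2$. For an absolutely continuous path $Z=(Z^1,\dots,Z^d):[0,1]\to\mathbb R^d$ and a word $w=w_1\cdots w_k$ over $\{1,\dots,d\}$, set $\langle S(Z),w\rangle=\int_{0<s_1<\dots<s_k<1}\dot Z^{w_1}(s_1)\cdots\dot Z^{w_k}(s_k)\,ds_1\cdots ds_k$ (and $1$ for the empty word); $S(Z)$ is the iterated-integrals signature, a formal series $\sum_w\langle S(Z),w\rangle w$. Its logarithm $\log S(Z)=\sum_{m\ge1}\frac{(-1)^{m-1}}{m}(S(Z)-1)^m$ (concatenation product of formal series) is a Lie series. Let $\mathbf c_{\le2}(Z)$ denote the projection of $\log S(Z)$ to word-length $\le2$, written in coordinates $c_i$ ($1\le i\le d$) and $c_{ij}$ ($i<j$) as $\sum_i c_i\,i+\sum_{i<j}c_{ij}[i,j]$; identify it with $(v,M)\in\mathbb R^d\oplus\mathfrak{so}(d,\mathbb R)$, $v=(c_1,\dots,c_d)^\top$, $M_{ij}=c_{ij}=-M_{ji}$. $O_d(\mathbb R)$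 acts on such pairs by $A\cdot(v,M)=(Av,AMA^\top)$ and on paths by $(AZ)_t=AZ_t$. $\mathcal U_{d;\le2}$: on $V_{\mathbb C}=\mathbb C^d\oplus\mathfrak{so}(d,\mathbb C)$ with $O_d(\mathbb C)=\{A:AA^\top=I\}$ acting the same way, let $L^{(1)}=\{c_1=\dots=c_{d-1}=0\}$ and for $2\le i\le d-1$, $L^{(i)}=\{(v,M)\in L^{(i-1)}: c_{k(d-i+2)}=0,\ 1\le k\le d-i\}$. Let $f_1=c_1^2+\dots+c_d^2$; for $2\le i\le d-1$ let $f_i$ be the $O_d(\mathbb C)$-invariant rational function whose restriction to $L^{(i-1)}$ is $c_{1(d-i+2)}^2+\dots+c_{(d-i+1)(d-i+2)}^2$; let $f_d$ be the one whose restriction to $L^{(d-1)}$ is $c_{12}^2$ (these exist, have real coefficients and are uniquely determined). $\mathcal U_{d;\le2}$ is the set of real $(v,M)$ in the domain of all $f_k$ with all $f_k(v,M)\neq0$. $\mathcal K_{d;\le2}=\{(v,M): c_i=0\ (i\le d-1),\ c_{j(i+1)}=0\ (1\le j<i\le d-1),\ c_d>0,\ c_{i(i+1)}>0\ (i\le d-1)\}$. $\tilde\rho_d:\mathcal U_{d;\le2}\to O_d(\mathbb R)$ is the moving frame assigning to $\mathbf c$ the unique $g\in O_d(\mathbb R)$ with $g\cdot\mathbf c\in\mathcal K_{d;\le2}$ (it exists and is unique on $\mathcal U_{d;\le2}$). *)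

(* Defs.v *)
From HB Require Import structures.
From mathcomp Require Import all_boot all_order all_algebra.
From mathcomp Require Import all_classical all_reals all_analysis.

Set Implicit Arguments.
Unset Strict Implicit.
Unset Printing Implicit Defensive.
Import Order.TTheory GRing.Theory Num.Theory.
Import numFieldNormedType.Exports.
Local Open Scope classical_set_scope.
Local Open Scope ring_scope.

Section Defs.
Variables (R : realType) (d : nat).

(* A rpath [0,1] -> R^d; values outside [0,1] are irrelevant. *)
Definition rpath := R -> 'cV[R]_d.

Definition coord (Z : rpath) (i : 'I_d) : R -> R := fun t => Z t i 0.

Definition abs_cont01 (f : R -> R) : Prop :=
  forall e : R, 0 < e -> exists2 del : R, 0 < del &
    forall (n : nat) (a b : nat -> R),
      (forall k, (k < n)%N ->
         [/\ 0 <= a k, a k <= b k, b k <= 1 & ((k.+1 < n)%N -> b k <= a k.+1)]) ->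
      \sum_(k < n) (b k - a k) < del ->
      \sum_(k < n) `|f (b k) - f (a k)| < e.

Definition abs_cont_path (Z : rpath) : Prop := forall i, abs_cont01 (coord Z i).

(* Iterated integrals, defined recursively on the REVERSED word:
   <S(Z)_t, w i> = int_0^t <S(Z)_s, w> dZ^i_s = int_0^t <S(Z)_s, w> (Z^i)'(s) ds. *)
Fixpoint sig_rev (Z : rpath) (rw : seq 'I_d) (t : R) : R :=
  match rw with
  | [::] => 1
  | i :: rw' =>
      Rintegral (@lebesgue_measure R) `[0, t]
        (fun s => sig_rev Z rw' s * derive1 (coord Z i) s)
  end.

Definition signature (Z : rpath) (w : seq 'I_d) : R := sig_rev Z (rev w) 1.

(* Coefficients of log S(Z) at words of length 1 and 2.  Only the m = 1, 2
   terms of log S = sum (-1)^(m-1)/m (S-1)^m contribute in length <= 2: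
   <log S, i> = <S, i>,  <log S, i j> = <S, i j> - 1/2 <S, i> <S, j>. *)
Definition logsig1 (Z : rpath) (i : 'I_d) : R := signature Z [:: i].
Definition logsig2 (Z : rpath) (i j : 'I_d) : R :=
  signature Z [:: i; j] - 2^-1 * (signature Z [:: i] * signature Z [:: j]).

(* c_{<=2}(Z) identified with (v, M) in R^d (+) so(d): v_i = c_i and
   M_ij = c_ij (i < j), M_ij = - c_ji (i > j), M_ii = 0, where c_ij (i<j) is
   the coefficient of [i,j] = ij - ji in log S, i.e. the coefficient of ij. *)
Definition c_le2 (Z : rpath) : 'cV[R]_d * 'M[R]_d :=
  (\col_i logsig1 Z i,
   \matrix_(i, j) (if (i < j)%N then logsig2 Z i j
                   else if (j < i)%N then - logsig2 Z j i else 0)).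

Definition orthogonal_mx (A : 'M[R]_d) : Prop := A *m A^T = 1%:M.

Definition act (A : 'M[R]_d) (c : 'cV[R]_d * 'M[R]_d) : 'cV[R]_d * 'M[R]_d :=
  (A *m c.1, A *m c.2 *m A^T).

Definition act_path (A : 'M[R]_d) (Z : rpath) : rpath := fun t => A *m Z t.

(* The cross-section K_{d;<=2} (0-based indices: p, q in 'I_d):
   c_i = 0 for i <= d-1 (1-based), c_d > 0; c_{j(i+1)} = 0 for j < i,
   c_{i(i+1)} > 0. *)
Definition K_set (c : 'cV[R]_d * 'M[R]_d) : Prop :=
  [/\ (forall p : 'I_d, (p.+1 < d)%N -> c.1 p 0 = 0),
      (forall p : 'I_d, p.+1 = d -> 0 < c.1 p 0),
      (forall p q : 'I_d, (p.+1 < q)%N -> c.2 p q = 0) &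
      (forall p q : 'I_d, p.+1 = q -> 0 < c.2 p q)].

Definition krylov (c : 'cV[R]_d * 'M[R]_d) (a : nat) : 'cV[R]_d := c.2 ^+ a *m c.1.

Definition gramD (c : 'cV[R]_d * 'M[R]_d) (k : nat) : R :=
  \det (\matrix_(a < k, b < k) ((krylov c a)^T *m krylov c b) 0 0).

(* For k >= 1 (truncated subtraction gives D_{k-2} = D_0 = 1 when k = 1, 2). *)
Definition f_inv (c : 'cV[R]_d * 'M[R]_d) (k : nat) : R :=
  gramD c k * gramD c (k - 2) / (gramD c (k - 1)) ^+ 2.

(* Domain of f_k: D_{k-1} <> 0. *)
Definition U_set (c : 'cV[R]_d * 'M[R]_d) : Prop :=
  forall k : nat, (1 <= k <= d)%N -> gramD c (k - 1) <> 0 /\ f_inv c k <> 0.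

(* The moving frame: the (unique on U) g in O_d(R) with g . c in K. *)
Definition rho (c : 'cV[R]_d * 'M[R]_d) : 'M[R]_d :=
  xget 1%:M (fun g => orthogonal_mx g /\ K_set (act g c)).

End Defs.

(* Main.v *)
(** A matrix [A] acts linearly on signatures: level [k] of [S(AZ)] is the image
    of level [k] of [S(Z)] under the [k]-th tensor power of [A]. So [S(Z)]
    determines [S(AZ)], and [c_le2] is equivariant. Hence [S(gZ) = S(Z~)] gives [c_le2 Z~ = g . c_le2 Z],
    and uniqueness of the frame yields [rho (c_le2 Z~) g = rho (c_le2 Z)].

    Linearity of the iterated integrals needs the derivatives of [Z] to exist
    almost everywhere and to be integrable, i.e. the Lebesgue theorem that an
    absolutely continuous function is the integral of its derivative. It is
    obtained by splitting the function into two nondecreasing absolutely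
    continuous ones through its total variation, whose Lebesgue-Stieltjes
    measures are dominated by Lebesgue measure; Radon-Nikodym gives the densities
    and the Lebesgue differentiation theorem identifies them with the derivative.
    The skew-symmetry of the second level of [log S] is integration by parts,
    that is, the same theorem applied to the product of two coordinates.

    The frame exists because Gram-Schmidt (here: a QR decomposition) applied to
    the Krylov vectors [v, M v, ..., M^(d-1) v] turns [M] into Hessenberg form. *)
Require Import Defs.
From HB Require Import structures.
From mathcomp Require Import all_boot all_order all_algebra.
From mathcomp Require Import all_classical all_reals all_analysis.
From mathcomp Require Import measurable_realfun ring lra zify.

Set Implicit Arguments.
Unset Strict Implicit.
Unset Printing Implicit Defensive.
Import Order.TTheory GRing.Theory Num.Theory.
Import numFieldNormedType.Exports.
Local Open Scope classical_set_scope.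
Local Open Scope ring_scope.

(** * The moving frame *)

Section qr.
Variable R : rcfType.

Lemma trmx_mul_self n (a : 'cV[R]_n) : (a^T *m a) 0 0 = \sum_i a i 0 ^+ 2.
Proof. by rewrite mxE; apply: eq_bigr => i _; rewrite mxE expr2. Qed.

Lemma trmx_mul_self_gt0 n (a : 'cV[R]_n) : a != 0 -> 0 < (a^T *m a) 0 0.
Proof.
move=> a0; rewrite trmx_mul_self lt_neqAle sumr_ge0 ?andbT => [|i _]; last first.
  by rewrite sqr_ge0.
apply: contraNneq a0 => /esym/eqP; rewrite psumr_eq0 => [/allP h|i _]; last first.
  by rewrite sqr_ge0.
apply/eqP/matrixP => i j; rewrite ord1 mxE; apply/eqP.
by have := h i (mem_index_enum _); rewrite sqrf_eq0.
Qed.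

(** The reflection along [w = a - al *: e], with [al] the norm of [a], exchanges [a] and [al *: e];
    when [w] vanishes the identity serves. *)
Lemma householder n (a : 'cV[R]_(1 + n)) : a != 0 ->
  exists H : 'M[R]_(1 + n), exists al : R,
    [/\ H *m H^T = 1%:M, 0 < al & H *m a = al *: col_mx 1%:M 0].
Proof.
move=> a0; pose al := Num.sqrt ((a^T *m a) 0 0).
have aa0 := trmx_mul_self_gt0 a0.
have al0 : 0 < al by rewrite sqrtr_gt0.
have al2 : (a^T *m a) 0 0 = al ^+ 2 by rewrite sqr_sqrtr// ltW.
pose e : 'cV[R]_(1 + n) := col_mx 1%:M 0.
have ee : (e^T *m e) 0 0 = 1.
  by rewrite tr_col_mx mul_row_col !trmx0 mulmx0 addr0 trmx1 mulmx1 mxE.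
pose w := a - al *: e.
have [w0|w0] := eqVneq w 0.
  exists 1%:M, al; split; rewrite ?trmx1 ?mulmx1// mul1mx.
  by apply/eqP; rewrite -subr_eq0; apply/eqP.
have ww0 := trmx_mul_self_gt0 w0.
have sc m (x : 'M[R]_1) (y : 'M[R]_(1, m)) : x *m y = x 0 0 *: y.
  by rewrite {1}[x]mx11_scalar mul_scalar_mx.
have scr m (x : 'M[R]_1) (y : 'M[R]_(m, 1)) : y *m x = x 0 0 *: y.
  by rewrite {1}[x]mx11_scalar mul_mx_scalar.
have ae : (e^T *m a) 0 0 = (a^T *m e) 0 0.
  by rewrite -[in RHS](trmxK e) -trmx_mul [in RHS]mxE.
set c := (w^T *m w) 0 0.
(* Because [a] and [al *: e] have equal norms, [w] pairs with [a] to half of its own square, so the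
   factor [2 / c] turns [a] into [a - w]. *)
have cE : c = 2 * (w^T *m a) 0 0.
  have wT : w^T = a^T - al *: e^T by rewrite linearB/= linearZ.
  have wx x : (w^T *m x) 0 0 = (a^T *m x) 0 0 - al * (e^T *m x) 0 0.
    by rewrite wT mulmxBl -scalemxAl !mxE.
  have xw x : (x *m w) 0 0 = (x *m a) 0 0 - al * (x *m e) 0 0.
    by rewrite mulmxBr -scalemxAr !mxE.
  by rewrite /c wx !xw wx al2 ee ae; ring.
exists (1%:M - (2 / c) *: (w *m w^T)), al; split => //.
- have -> : (1%:M - (2 / c) *: (w *m w^T))^T = 1%:M - (2 / c) *: (w *m w^T).
    by rewrite linearB/= linearZ/= trmx1 trmx_mul trmxK.
  set W := w *m w^T; have WW : W *m W = c *: W.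
    by rewrite /W mulmxA -(mulmxA w) scr -scalemxAl.
  rewrite mulmxBl mul1mx -scalemxAl mulmxBr mulmx1 -scalemxAr WW scalerBr !scalerA.
  rewrite (_ : 2 / c * (2 / c) * c = 2 / c + 2 / c); last by field; rewrite gt_eqF.
  by rewrite scalerDl opprB addrK subrK.
- rewrite mulmxBl mul1mx -scalemxAl -mulmxA scr scalerA.
  have -> : 2 / c * (w^T *m a) 0 0 = 1.
    by rewrite mulrAC -cE divff// gt_eqF.
  by rewrite scale1r /w opprB addrC subrK.
Qed.

(** Induction on the size: a reflection sends the first column to a positive multiple of the first
    basis vector. The lower right block is again invertible, since the determinant of a block
    triangular matrix factors. *)
Lemma qr_positive n (A : 'M[R]_n) : A \in unitmx ->
  exists2 Q : 'M[R]_n, Q *m Q^T = 1%:M &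
    (forall i j : 'I_n, (j < i)%N -> (Q *m A) i j = 0) /\
    (forall i, 0 < (Q *m A) i i).
Proof.
elim: n A => [|n IHn] A uA.
  by exists 1%:M; [rewrite trmx1 mulmx1|split=> -[]].
rewrite -[n.+1]/(1 + n)%N in A uA *.
(* A zero first column would put the first basis vector in the kernel of [A]. *)
have a0 : lsubmx A != 0.
  apply/eqP => a0; have : A *m col_mx 1%:M 0 = 0.
    by rewrite -(hsubmxK A) a0 mul_row_col mul0mx mulmx0 addr0.
  move=> /(congr1 (mulmx (invmx A))); rewrite mulKmx// mulmx0.
  move=> /(congr1 usubmx); rewrite col_mxKu => /matrixP/(_ 0 0)/eqP.
  by rewrite !mxE eqxx oner_eq0.
have [H [al [HH al0 Ha]]] := householder a0.
set B := H *m A.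
have lB : lsubmx B = al *: col_mx 1%:M 0
  by rewrite -Ha /B -{1}(hsubmxK A) mul_mx_row row_mxKl.
have BE : B = block_mx al%:M (usubmx (rsubmx B)) 0 (dsubmx (rsubmx B)).
  rewrite -{1}(hsubmxK B) lB -{1}(vsubmxK (rsubmx B)) block_mxEh.
  by rewrite scale_col_mx scalemx1 scaler0.
have [uH _] := mulmx1_unit HH.
have uD : dsubmx (rsubmx B) \in unitmx.
  have : B \in unitmx by rewrite unitmx_mul uH uA.
  by rewrite {1}BE !unitmxE det_ublock unitrM => /andP[_].
have [Q QQ [Ql Qd]] := IHn _ uD.
exists (block_mx 1%:M 0 0 Q *m H).
  rewrite trmx_mul mulmxA -(mulmxA _ H) HH mulmx1 tr_block_mx mulmx_block.
  by rewrite !trmx0 !trmx1 !(mulmx0, mul0mx, addr0, add0r) mulmx1 QQ scalar_mx_block.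
rewrite -mulmxA -/B {1 2}BE mulmx_block !(mulmx0, mul0mx, addr0, add0r) !mul1mx.
split=> [i j|i].
  rewrite -[i]fintype.splitK -[j]fintype.splitK.
  case: (fintype.split i) => {}i; case: (fintype.split j) => {}j /=; rewrite ?ord1 //=.
  - by rewrite block_mxEdl mxE.
  - by rewrite !add1n ltnS => ji; rewrite block_mxEdr Ql.
rewrite -[i]fintype.splitK; case: (fintype.split i) => {}i /=.
  by rewrite block_mxEul ord1 mxE eqxx mulr1n.
by rewrite block_mxEdr Qd.
Qed.

End qr.

(** * Existence and uniqueness of the frame *)

Section frame.
Variables (R : realType) (d : nat).
Implicit Types (c : 'cV[R]_d * 'M[R]_d) (g h : 'M[R]_d).

Lemma orthogonal_mx_tr g : orthogonal_mx g -> orthogonal_mx g^T.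
Proof. by rewrite /orthogonal_mx trmxK => /mulmx1C. Qed.

Lemma orthogonal_mxM g h :
  orthogonal_mx g -> orthogonal_mx h -> orthogonal_mx (g *m h).
Proof.
move=> gg hh; rewrite /orthogonal_mx trmx_mul mulmxA -(mulmxA g) hh mulmx1.
exact: gg.
Qed.

Lemma actM g h c : act g (act h c) = act (g *m h) c.
Proof. by rewrite /act /= trmx_mul !mulmxA. Qed.

Lemma krylov_conj g c k : orthogonal_mx g ->
  g *m krylov c k.+1 = (g *m c.2 *m g^T) *m (g *m krylov c k).
Proof.
move=> /mulmx1C gg; rewrite !mulmxA -(mulmxA _ g^T) gg mulmx1 /krylov exprS.
by rewrite -!mulmxA.
Qed.

(** [gramD c d] is the squared determinant of the Krylov matrix [A], which is thus invertible. [N]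
    sends column [k] of the triangular matrix [T] to column [k.+1], and the positive diagonal of [T]
    forces [N] to vanish below a positive subdiagonal. *)
Lemma K_set_frame_exists c : gramD c d != 0 ->
  exists2 g, orthogonal_mx g & K_set (act g c).
Proof.
move=> Dd; pose A : 'M[R]_d := \matrix_(i, j) krylov c j i 0.
have uA : A \in unitmx.
  rewrite unitmxE unitfE; apply: contra_neq Dd => A0.
  have -> : gramD c d = \det (A^T *m A).
    congr (\det _); apply/matrixP => i j; rewrite !mxE.
    by apply: eq_bigr => k _; rewrite !mxE.
  by rewrite det_mulmx A0 mulr0.
have [Q QQ [Tl Td]] := qr_positive uA.
pose T := Q *m A; pose N := Q *m c.2 *m Q^T.
have TE k i : T i k = (Q *m krylov c k) i 0.
  by rewrite !mxE; apply: eq_bigr => j _; rewrite !mxE.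
have NT (i k k' : 'I_d) : k' = k.+1 :> nat -> T i k' = \sum_l N i l * T l k.
  move=> kk; rewrite TE kk krylov_conj// mxE; apply: eq_bigr => l _.
  by rewrite TE.
(* Strong induction on [k]: in the expansion of [T i k.+1 = 0] the terms [l < k] vanish by induction
   and the terms [l > k] by triangularity, leaving [N i k * T k k]. *)
have N0 (k i : 'I_d) : (k.+1 < i)%N -> N i k = 0.
  have [m] := ubnP k; elim: m k => // m IHm k; rewrite ltnS => km ki.
  have kd : (k.+1 < d)%N by exact: ltn_trans (ltn_ord i).
  have := NT i k (Ordinal kd) erefl; rewrite Tl// (bigD1 k)//= big1 ?addr0.
    by move/esym/eqP; rewrite mulf_eq0 (gt_eqF (Td k)) orbF => /eqP.
  move=> l lk; have [kl|lk'|/val_inj kl] := ltngtP k l.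
  - by rewrite [T l k]Tl// mulr0.
  - by rewrite IHm ?mul0r ?(leq_trans lk')// (ltn_trans _ ki)// ltnS.
  - by rewrite kl eqxx in lk.
have N1 (k i : 'I_d) : i = k.+1 :> nat -> 0 < N i k.
  move=> ik; have := Td i; rewrite -/T (NT i k i ik) (bigD1 k)//= big1 ?addr0.
    by rewrite pmulr_lgt0// Td.
  move=> l lk; have [kl|lk'|/val_inj kl] := ltngtP k l.
  - by rewrite [T l k]Tl// mulr0.
  - by rewrite N0 ?mul0r ?ik ?ltnS.
  - by rewrite kl eqxx in lk.
(* [Q] puts [c.1] along the first basis vector, the cross-section wants the last; reversing the
   basis also moves the subdiagonal of [N] above the diagonal. *)
pose g : 'M[R]_d := \matrix_(i, j) Q (rev_ord i) j.
have gE (i : 'I_d) (x : 'cV[R]_d) : (g *m x) i 0 = (Q *m x) (rev_ord i) 0.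
  by rewrite !mxE; apply: eq_bigr => j _; rewrite !mxE.
have gNE i j : (g *m c.2 *m g^T) i j = N (rev_ord i) (rev_ord j).
  rewrite !mxE; apply: eq_bigr => k _; rewrite !mxE; congr (_ * _).
  by apply: eq_bigr => l _; rewrite !mxE.
exists g.
  apply/matrixP => i j; move/matrixP/(_ (rev_ord i) (rev_ord j)): QQ.
  rewrite !mxE (inj_eq rev_ord_inj) => <-.
  by apply: eq_bigr => k _; rewrite !mxE.
have vE (p k : 'I_d) : k = 0%N :> nat -> (g *m c.1) p 0 = T (rev_ord p) k.
  by move=> k0; rewrite gE TE k0 /krylov expr0 mul1mx.
split=> [p pd|p pd|p q pq|p q pq] /=.
- have d0 : (0 < d)%N by exact: leq_trans pd.
  by rewrite (vE _ (Ordinal d0))// [T _ _]Tl//= subn_gt0.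
- have d0 : (0 < d)%N by rewrite -pd.
  rewrite (vE _ (Ordinal d0))// (_ : Ordinal d0 = rev_ord p) ?Td//.
  by apply/val_inj; rewrite /= pd subnn.
- rewrite gNE N0//=.
  by have := ltn_ord q; move: pq; lia.
- rewrite gNE N1//=.
  by have := ltn_ord q; rewrite -pq; lia.
Qed.

(* [g] fixes the last basis vector and, going down, each [e_q]: column [q] of
   [M] gives [e_(q-1)] up to a positive factor modulo [e_q, ..., e_(d-1)]. *)
Lemma K_set_orthogonal_eq1 g c : orthogonal_mx g ->
  K_set c -> K_set (act g c) -> g = 1%:M.
Proof.
move=> gg [v0 v1 M0 M1] [w0 w1 N0 N1]; have gT := orthogonal_mx_tr gg.
pose N := (act g c).2; rewrite -/N in N0 N1.
have gM : g *m c.2 = N *m g.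
  by rewrite /N /= -!mulmxA (_ : g^T *m g = 1%:M) ?mulmx1//; exact/mulmx1C.
have normcol q : \sum_i g i q ^+ 2 = 1.
  have /matrixP/(_ q q) := gT; rewrite trmxK !mxE eqxx mulr1n => <-.
  by apply: eq_bigr => i _; rewrite !mxE expr2.
have orth p q : p != q -> \sum_i g i p * g i q = 0.
  move=> pq; have /matrixP/(_ p q) := gT; rewrite trmxK !mxE (negbTE pq) mulr0n => h; rewrite -[RHS]h.
  by apply: eq_bigr => i _; rewrite !mxE.
have colE q : (forall i, i != q -> g i q = 0) -> 0 <= g q q ->
    forall i, g i q = (i == q)%:R.
  move=> gq gqq i; have [->|/gq//] := eqVneq i q.
  have := normcol q; rewrite (bigD1 q)//= big1 ?addr0 => [|j /gq->]; last first.
    by rewrite expr0n.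
  by move/eqP; rewrite sqrp_eq1// => /eqP.
suff gE (q i : 'I_d) : g i q = (i == q)%:R.
  by apply/matrixP => i q; rewrite mxE.
(* Descending induction on [q]: the last column of [g] is read off [c.1], column [q] off column
   [q.+1] of the matrices. *)
have [m] := ubnP (d - q); elim: m q i => // m IHm q i; rewrite ltnS => qm.
have [qd|qd] := eqVneq q.+1 d.
  have gv j : (g *m c.1) j 0 = g j q * c.1 q 0.
    rewrite mxE (bigD1 q)//= big1 ?addr0// => p pq; rewrite v0 ?mulr0//.
    rewrite ltn_neqAle ltn_ord andbT; apply: contra pq => /eqP pd.
    by apply/eqP/val_inj/succn_inj; rewrite pd qd.
  have c0 := v1 q qd.
  apply: colE => [j jq|].
    have := w0 j; rewrite /= gv => /(_ _)/eqP; rewrite mulf_eq0 (gt_eqF c0) orbF.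
    move=> h; apply/eqP/h; rewrite ltn_neqAle ltn_ord andbT.
    by apply: contra jq => /eqP jd; apply/eqP/val_inj/succn_inj; rewrite jd qd.
  by have := w1 q qd; rewrite /= gv pmulr_lgt0// => /ltW.
have qlt : (q.+1 < d)%N by rewrite ltn_neqAle qd ltn_ord.
pose r := Ordinal qlt.
have IHr (p : 'I_d) : (q < p)%N -> forall i, g i p = (i == p)%:R.
  by move=> qp j; apply: IHm; apply: leq_trans qm; rewrite ltn_sub2l.
(* Column [q] is orthogonal to the later columns, already known to be basis vectors. *)
have gq0 (p : 'I_d) : (q < p)%N -> g p q = 0.
  move=> qp; have := @orth p q; rewrite (bigD1 p)//= big1 ?addr0 => [|j jp].
    by rewrite IHr// eqxx mul1r; apply; rewrite neq_ltn qp orbT.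
  by rewrite IHr// (negbTE jp) mul0r.
(* Entry [(j, r)] of [gM]: column [r] of [g] is known, and column [r] of [c.2] vanishes above row
   [q], so column [q] is the only unknown one. *)
have colr j : g j q * c.2 q r + \sum_(p < d | (q < p)%N) (j == p)%:R * c.2 p r = N j r.
  have /matrixP/(_ j r) := gM; rewrite [RHS]mxE (bigD1 r)//= big1 ?addr0; last first.
    by move=> p pr; rewrite (@IHr r)//= (negbTE pr) mulr0.
  rewrite (@IHr r)//= eqxx mulr1 => <-; rewrite [RHS]mxE [RHS](bigID (fun p : 'I_d => (q < p)%N))/=.
  rewrite [RHS]addrC; congr (_ + _); last by apply: eq_bigr => p qp; rewrite IHr.
  rewrite [RHS](bigD1 q) ?ltnn//= big1 ?addr0// => p /andP[]; rewrite -leqNgt => pq pNq.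
  by rewrite M0 ?mulr0//= ltnS ltn_neqAle pNq.
have colq (j : 'I_d) : (j <= q)%N -> g j q * c.2 q r = N j r.
  move=> jq; rewrite -colr big1 ?addr0// => p qp.
  by rewrite (_ : (j == p) = false) ?mul0r//; apply/eqP => jp; rewrite jp leqNgt qp in jq.
have c0 : 0 < c.2 q r by exact: M1.
apply: colE => [j jq|].
  have [qj|jlq|/val_inj qj] := ltngtP q j; first exact: gq0.
    have := colq j (ltnW jlq); rewrite N0 ?ltnS// => /eqP.
    by rewrite mulf_eq0 (gt_eqF c0) orbF => /eqP.
  by rewrite qj eqxx in jq.
have := N1 q r erefl; rewrite -(colq q)// pmulr_lgt0//; exact: ltW.
Qed.

(** [U_set] at [k = d] makes [f_inv c d], hence its factor [gramD c d], nonzero; for [d = 0] the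
    latter is an empty determinant. *)
Lemma rhoP c : U_set c -> orthogonal_mx (rho c) /\ K_set (act (rho c) c).
Proof.
move=> Uc; apply: (@xgetPex _ _ (fun g => orthogonal_mx g /\ K_set (act g c))).
have Dd : gramD c d != 0.
  have D0 m : m = 0%N -> gramD c m != 0 by move=> ->; rewrite /gramD det_mx00 oner_eq0.
  have [/D0//|d0] := posnP d.
  have [|_ /eqP] := Uc d; first by rewrite d0 leqnn.
  by apply: contra_neq; rewrite /f_inv => ->; rewrite !mul0r.
by have [g gg Kg] := K_set_frame_exists Dd; exists g.
Qed.

(** [h] carries the point [act (rho c) c] of the cross-section to a point of the cross-section, so
    it is the identity. *)
Lemma rho_act g c : orthogonal_mx g -> U_set c -> U_set (act g c) ->
  rho (act g c) *m g = rho c.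
Proof.
move=> gg Uc Ugc; have [orc Krc] := rhoP Uc; have [orgc Krgc] := rhoP Ugc.
pose h := rho (act g c) *m g *m (rho c)^T.
have oh : orthogonal_mx h.
  by apply/orthogonal_mxM/orthogonal_mx_tr => //; exact: orthogonal_mxM.
have ro : (rho c)^T *m rho c = 1%:M by exact/mulmx1C.
have : h = 1%:M.
  apply: (@K_set_orthogonal_eq1 _ (act (rho c) c)) => //.
  by rewrite actM /h -mulmxA ro mulmx1 -actM.
by move=> /(congr1 (mulmx^~ (rho c))); rewrite /h -mulmxA ro mulmx1 mul1mx.
Qed.

End frame.

(** * Absolutely continuous functions *)

Section chain.
Variable R : realType.
Implicit Types (f h : R -> R) (s : seq (R * R)) (lo : R).

(** Families of non-overlapping intervals are kept as lists, so that subdividing one of them is a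
    concatenation and reordering them is a sort. *)
Fixpoint chain lo s : bool :=
  if s is p :: s' then [&& lo <= p.1, p.1 <= p.2 & chain p.2 s'] else lo <= 1.

Definition chain_length s : R := \sum_(p <- s) (p.2 - p.1).

Definition chain_var f s : R := \sum_(p <- s) `|f p.2 - f p.1|.

Definition abs_cont_chain f := forall e : R, 0 < e -> exists2 del : R, 0 < del &
  forall s, chain 0 s -> chain_length s < del -> chain_var f s < e.

Lemma chainW lo lo' s : lo <= lo' -> chain lo' s -> chain lo s.
Proof.
by case: s => [|p s]/= ll; [exact: le_trans|move=> /andP[+ ->]; move/(le_trans ll)->].
Qed.

Lemma chain_le1 lo s : chain lo s -> lo <= 1.
Proof.
by elim: s lo => //= p s IHs lo /and3P[lp pp /IHs p1]; rewrite (le_trans lp)// (le_trans pp).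
Qed.

Lemma chain_mem lo s p : chain lo s -> p \in s -> [/\ lo <= p.1, p.1 <= p.2 & p.2 <= 1].
Proof.
elim: s lo => //= q s IHs lo /and3P[lq qq qs]; rewrite inE => /predU1P[->|ps].
  by split => //; exact: chain_le1 qs.
by have [qp pp p1] := IHs _ qs ps; split => //; rewrite (le_trans lq)// (le_trans qq).
Qed.

Lemma chain_nth x0 lo s k : chain lo s -> (k.+1 < size s)%N ->
  (nth x0 s k).2 <= (nth x0 s k.+1).1.
Proof.
elim: s lo k => //= p s IHs lo [|k]; last by move=> /and3P[_ _ /IHs]; apply.
by case: s IHs => //= q s _ /and3P[_ _ /andP[]].
Qed.

Lemma abs_cont01_chain f : abs_cont01 f -> abs_cont_chain f.
Proof.
move=> acf e e0; have [del del0 facf] := acf e e0; exists del => // s cs slen.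
pose a k := (nth (0, 0) s k).1; pose b k := (nth (0, 0) s k).2.
have sumE (F : R * R -> R) : \sum_(p <- s) F p = \sum_(k < size s) F (a k, b k).
  rewrite (big_nth (0, 0)) big_mkord; apply: eq_bigr => k _.
  by rewrite /a /b -surjective_pairing.
rewrite /chain_var sumE; apply: facf => [k ks|]; last by rewrite -(sumE (fun p => p.2 - p.1)).
have [ap pb b1] := chain_mem cs (mem_nth (0, 0) ks); split => // k1s.
exact: chain_nth cs k1s.
Qed.

Lemma abs_cont_chainB f h :
  abs_cont_chain f -> abs_cont_chain h -> abs_cont_chain (fun x => f x - h x).
Proof.
move=> acf ach e e0; have e20 : 0 < e / 2 by rewrite divr_gt0.
have [d1 d10 fd] := acf _ e20; have [d2 d20 hd] := ach _ e20.
exists (Num.min d1 d2); first by rewrite lt_min d10.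
move=> s cs; rewrite lt_min => /andP[/(fd _ cs) fe /(hd _ cs) he].
rewrite [e]splitr; apply: le_lt_trans (ltrD fe he).
rewrite /chain_var -big_split/=; apply: ler_sum => p _.
rewrite (_ : _ - _ - _ = (f p.2 - f p.1) - (h p.2 - h p.1)); first exact: ler_normB.
by ring.
Qed.

Lemma abs_cont_chainM f h (K : R) :
  (forall x, 0 <= x <= 1 -> `|f x| <= K) -> (forall x, 0 <= x <= 1 -> `|h x| <= K) ->
  abs_cont_chain f -> abs_cont_chain h -> abs_cont_chain (fun x => f x * h x).
Proof.
move=> fK hK acf ach e e0.
have K0 : 0 <= K by apply: le_trans (fK 0 _); rewrite ?lexx ?ler01.
(* [K] itself may be zero and could not serve as a divisor. *)
have K10 : 0 < K + 1 by rewrite ltr_wpDl.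
pose e' := e / (2 * (K + 1)).
have e'0 : 0 < e' by rewrite divr_gt0// mulr_gt0.
have [d1 d10 fd] := acf _ e'0; have [d2 d20 hd] := ach _ e'0.
exists (Num.min d1 d2); first by rewrite lt_min d10.
move=> s cs; rewrite lt_min => /andP[/(fd _ cs) fe /(hd _ cs) he].
have -> : e = (K + 1) * e' + (K + 1) * e'.
  by rewrite /e'; field; rewrite gt_eqF.
apply: (@le_lt_trans _ _ ((K + 1) * chain_var f s + (K + 1) * chain_var h s)).
  rewrite /chain_var !mulr_sumr -big_split/= !big_seq; apply: ler_sum => p ps.
  have [p0 pp p1] := chain_mem cs ps.
  have -> : f p.2 * h p.2 - f p.1 * h p.1 =
    (f p.2 - f p.1) * h p.2 + f p.1 * (h p.2 - h p.1) by ring.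
  rewrite (le_trans (ler_normD _ _))// !normrM lerD//.
    rewrite mulrC ler_wpM2r// (le_trans (hK _ _)) ?lerDl//.
    by rewrite p1 (le_trans p0).
  rewrite ler_wpM2r// (le_trans (fK _ _)) ?lerDl//.
  by rewrite p0 (le_trans pp).
by rewrite ltrD// ltr_pM2l.
Qed.

Fixpoint steps (a : R) (l : seq R) : seq (R * R) :=
  if l is x :: l' then (a, x) :: steps x l' else [::].

Lemma steps_length a l : chain_length (steps a l) = last a l - a.
Proof.
elim: l a => [|x l IHl] a; first by rewrite /chain_length big_nil subrr.
by rewrite /chain_length big_cons -/(chain_length _) IHl /=; ring.
Qed.

Lemma steps_var a b f l : itv_partition a b l -> variation a b f l = chain_var f (steps a l).
Proof.
move=> /variation_zip ->; elim: l a => [|x l IHl] a; rewrite /chain_var ?big_nil//=.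
by rewrite !big_cons IHl.
Qed.

Lemma chain_steps lo s1 s2 a b l : itv_partition a b l ->
  chain lo (s1 ++ (a, b) :: s2) -> chain lo (s1 ++ steps a l ++ s2).
Proof.
move=> abl; elim: s1 lo => [|p s1 IHs] lo /=; last first.
  by move=> /and3P[-> -> /IHs].
move=> /and3P[la ab bs]; elim: l lo a {ab} la abl => [|x l IHl] lo a la /= abl.
  by rewrite -(itv_partition_nil abl) in bs; exact: chainW bs.
have [/=/andP[/ltW ax _] _] := abl.
by rewrite la ax/=; apply: IHl => //; exact: itv_partition_cons abl.
Qed.

(** Subdividing the intervals of a chain keeps its length, so the bound survives the supremum over
    all subdivisions. *)
Lemma chain_total_variation f (e del : R) :
  (forall s, chain 0 s -> chain_length s < del -> chain_var f s < e) ->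
  forall s, chain 0 s -> chain_length s < del ->
  (\sum_(p <- s) total_variation p.1 p.2 f <= e%:E)%E.
Proof.
move=> fe s.
(* [s1] collects the intervals already subdivided; the supremum is taken over one interval at a
   time. *)
suff H s1 : chain 0 (s1 ++ s) -> chain_length (s1 ++ s) < del ->
    ((chain_var f s1)%:E + \sum_(p <- s) total_variation p.1 p.2 f <= e%:E)%E.
  by move=> cs sl; have := H [::]; rewrite /chain_var big_nil add0e; apply.
elim: s s1 => [|[a b] s IHs] s1 cs sl.
  by rewrite big_nil adde0 lee_fin ltW// fe//; rewrite cats0 in cs sl.
have cs_ge0 : (0 <= \sum_(p <- s) total_variation p.1 p.2 f)%E.
  rewrite big_seq sume_ge0// => p ps; apply: total_variation_ge0.
  by have [] := chain_mem cs (_ : p \in _); rewrite ?mem_cat ?inE ?ps ?orbT.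
(* Finiteness allows subtraction in the extended reals; it comes from the induction hypothesis with
   [(a, b)] left undivided. *)
have cs_fin : (\sum_(p <- s) total_variation p.1 p.2 f)%E \is a fin_num.
  have := IHs (rcons s1 (a, b)); rewrite cat_rcons => /(_ cs sl).
  rewrite ge0_fin_numE// => h; rewrite ltNge; apply/negP; rewrite leye_eq => /eqP hy.
  by rewrite hy addey// in h.
rewrite big_cons/= addeCA -leeBrDr ?fin_numD ?cs_fin//.
apply: ge_ereal_sup => _ [_ [l abl <-] <-].
rewrite leeBrDr ?fin_numD ?cs_fin// addeA -EFinD.
have := IHs (s1 ++ steps a l); rewrite -catA => /(_ (chain_steps abl cs)).
rewrite (steps_var _ abl) /chain_var big_cat/= addrC; apply.
move: sl; rewrite /chain_length !big_cat/= big_cons/= -/(chain_length (steps a l)).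
by rewrite steps_length; case: abl => _ /eqP ->.
Qed.

(** The variation over an interval shorter than [del] is at most 1, and finitely many intervals of
    length [del / 2] cover [[0, x]]. *)
Lemma abs_cont_chain_tv_fin f x : abs_cont_chain f -> 0 <= x <= 1 ->
  total_variation 0 x f \is a fin_num.
Proof.
move=> acf /andP[x0 x1]; have [del del0 fdel] := acf 1 ltr01.
have small a b : 0 <= a -> a <= b -> b <= 1 -> b - a < del ->
    (total_variation a b f < +oo)%E.
  move=> a0 ab b1 bad; apply: (@le_lt_trans _ _ 1%:E); last by rewrite ltry.
  have := chain_total_variation fdel (s := [:: (a, b)]).
  by rewrite /chain_length !big_seq1/= a0 ab b1; apply.
rewrite ge0_fin_numE ?total_variation_ge0//.
pose eta := del / 2; have eta0 : 0 < eta by rewrite divr_gt0.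
have etad : eta < del by rewrite ltr_pdivrMr// ltr_pMr// ltr1n.
suff H k : forall y, 0 <= y -> y <= 1 -> y <= k%:R * eta -> (total_variation 0 y f < +oo)%E.
  apply: (H (Num.bound (eta^-1))) => //; rewrite -ler_pdivrMr//.
  apply: le_trans (ltW (archi_boundP _)); last by rewrite invr_ge0 ltW.
  by rewrite ler_pdivrMr// mulVf ?gt_eqF.
elim: k => [|k IHk] y y0 y1 yk.
  apply: small => //; rewrite subr0; apply: le_lt_trans del0.
  by rewrite mul0r in yk.
have [ye|ye] := leP y eta; first by apply: small => //; rewrite subr0 (le_lt_trans ye).
have yey : y - eta <= y by rewrite gerBl ltW.
have ye0 : 0 <= y - eta by rewrite subr_ge0 ltW.
rewrite (total_variationD _ ye0 yey) lte_add_pinfty//.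
  apply: IHk => //; first exact: le_trans y1.
  by rewrite lerBlDr; move: yk; rewrite -natr1 mulrDl mul1r.
by apply: small => //; rewrite subKr.
Qed.

(** Increments of the variation function are variations over the intervals, which
    [chain_total_variation] bounds. *)
Lemma abs_cont_chain_tv f : abs_cont_chain f ->
  abs_cont_chain (fun x => fine (total_variation 0 x f)).
Proof.
move=> acf e e0; have e20 : 0 < e / 2 by rewrite divr_gt0.
have [del del0 fdel] := acf _ e20; exists del => // s cs sl.
apply: (@le_lt_trans _ _ (e / 2)); last by rewrite ltr_pdivrMr// ltr_pMr// ltr1n.
rewrite -lee_fin; apply: le_trans (chain_total_variation fdel cs sl).
rewrite /chain_var -sumEFin big_seq [leRHS]big_seq; apply: lee_sum => p ps.
have [p0 pp p1] := chain_mem cs ps.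
have f1 : total_variation 0 p.1 f \is a fin_num.
  by apply: abs_cont_chain_tv_fin; rewrite // p0 (le_trans pp).
have f2 : total_variation 0 p.2 f \is a fin_num.
  by apply: abs_cont_chain_tv_fin; rewrite // p1 (le_trans p0).
have := total_variationD f p0 pp => tvD.
have f12 : total_variation p.1 p.2 f \is a fin_num.
  by move: f2; rewrite tvD fin_numD => /andP[].
rewrite tvD fineD// addrC addKr ger0_norm ?fine_ge0 ?total_variation_ge0//.
by rewrite fineK.
Qed.

(** With [T] the variation function, [T] and [T - f] are nondecreasing because increments of [f] are
    bounded by those of [T]. *)
Lemma abs_cont_chain_jordan f : abs_cont_chain f ->
  exists F G : R -> R, [/\ abs_cont_chain F /\ abs_cont_chain G,
    (forall x y, 0 <= x -> x <= y -> y <= 1 -> F x <= F y),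
    (forall x y, 0 <= x -> x <= y -> y <= 1 -> G x <= G y) &
    f = (fun x => F x - G x)].
Proof.
move=> acf; pose T x := fine (total_variation 0 x f).
have TE x y : 0 <= x -> x <= y -> y <= 1 -> `|f y - f x| <= T y - T x.
  move=> x0 xy y1; have := total_variationD f x0 xy => tvD.
  have f1 : total_variation 0 x f \is a fin_num.
    by apply: abs_cont_chain_tv_fin; rewrite // x0 (le_trans xy).
  have f2 : total_variation 0 y f \is a fin_num.
    by apply: abs_cont_chain_tv_fin; rewrite // y1 (le_trans x0).
  have f12 : total_variation x y f \is a fin_num.
    by move: f2; rewrite tvD fin_numD => /andP[].
  rewrite /T tvD fineD// addrAC subrr add0r -lee_fin fineK//.
  exact: total_variation_ge.
have acT : abs_cont_chain T by exact: abs_cont_chain_tv.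
exists T, (fun x => T x - f x); split => [|x y x0 xy y1|x y x0 xy y1|].
- by split => //; exact: abs_cont_chainB.
- by rewrite -subr_ge0 (le_trans _ (TE _ _ x0 xy y1)).
- have := le_trans (ler_norm _) (TE _ _ x0 xy y1); lra.
- by apply/funext => x; rewrite subKr.
Qed.

End chain.

(** * Absolutely continuous functions as integrals of their derivatives *)

Section density.
Variable R : realType.
Local Notation mu := (@lebesgue_measure R).
Implicit Types (f F G : R -> R) (s : seq (R * R)).

Definition has_density f (g : R -> R) :=
  mu.-integrable setT (EFin \o g) /\
  forall x, 0 <= x <= 1 -> f x - f 0 = \int[mu]_(t in `[0, x]) g t.

(** Retraction onto [[0, 1]]: composing with it extends a function to the whole line, where a
    Stieltjes measure needs its cumulative function. *)
Definition clamp (x : R) : R := Num.max 0 (Num.min 1 x).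

Lemma clamp_bounds x : 0 <= clamp x <= 1.
Proof. by rewrite /clamp le_max lexx ge_max ler01 ge_min lexx. Qed.

Lemma clamp_id x : 0 <= x <= 1 -> clamp x = x.
Proof. by move=> /andP[x0 x1]; rewrite /clamp min_r// max_r. Qed.

Lemma clamp_homo x y : x <= y -> clamp x <= clamp y.
Proof. by move=> xy; rewrite /clamp; case: (leP 1 x) => ?; case: (leP 1 y) => ?;
  case: (leP 0 x) => ?; case: (leP 0 y) => ?; case: (leP 0 (1 : R)) => ?; lra. Qed.

Lemma clamp_lipschitz x y : x <= y -> clamp y - clamp x <= y - x.
Proof. by move=> xy; rewrite /clamp; case: (leP 1 x) => ?; case: (leP 1 y) => ?;
  case: (leP 0 x) => ?; case: (leP 0 y) => ?; case: (leP 0 (1 : R)) => ?; lra. Qed.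

Lemma clamp_continuous F : abs_cont_chain F -> continuous (F \o clamp).
Proof.
move=> acF x; apply/cvgrPdist_lt => e e0; have [del del0 Fdel] := acF e e0.
have main u v : u <= v -> v - u < del -> `|F (clamp v) - F (clamp u)| < e.
  move=> uv vud; have := Fdel [:: (clamp u, clamp v)].
  rewrite /chain_length /chain_var !big_seq1/=; apply.
    have /andP[-> _] := clamp_bounds u; have /andP[_ ->] := clamp_bounds v.
    by rewrite clamp_homo.
  by apply: le_lt_trans vud; exact: clamp_lipschitz.
near=> y => /=; have xy : `|x - y| < del.
  by near: y; exact: cvgr_dist_lt.
have [yx|xy'] := leP y x; first by apply: main => //; exact: le_lt_trans (ler_norm _) xy.
by rewrite distrC; apply: main; [exact: ltW|rewrite distrC in xy; exact: le_lt_trans (ler_norm _) xy].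
Unshelve. all: by end_near. Qed.

(** Sort by left endpoints: since the intervals have positive length, of the two ways to be disjoint
    only the one in sorted order remains. *)
Lemma disjoint_itvs_chain s : uniq s ->
  (forall p, p \in s -> [/\ 0 <= p.1, p.1 < p.2 & p.2 <= 1]) ->
  (forall p q, p \in s -> q \in s -> p != q -> p.2 <= q.1 \/ q.2 <= p.1) ->
  exists2 s', perm_eq s s' & chain 0 s'.
Proof.
pose le1 (p q : R * R) := p.1 <= q.1.
have le1_trans : transitive le1 by move=> ? ? ?; exact: le_trans.
have le1_total : total le1 by move=> p q; exact: le_total.
move=> us sb sd; exists (sort le1 s); first by rewrite perm_sym perm_sort.
have := sort_sorted le1_total s; have := sort_uniq le1 s.
have := mem_sort le1 s; move: (sort le1 s) => t ts; rewrite us.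
have {}sb p : p \in t -> [/\ 0 <= p.1, p.1 < p.2 & p.2 <= 1] by rewrite ts; exact: sb.
have {}sd p q : p \in t -> q \in t -> p != q -> p.2 <= q.1 \/ q.2 <= p.1.
  by rewrite !ts; exact: sd.
move=> ut st.
suff H (lo : R) : lo <= 1 -> (forall p, p \in t -> lo <= p.1) -> chain lo t.
  by apply: H => // p /sb[].
elim: t {ts us} lo sb sd ut st => //= p t IHt lo sb sd /andP[pt ut] pst lo1 lop.
have [p0 pp p1] := sb p (mem_head _ _).
rewrite lop ?mem_head//= ltW//=; apply: IHt => //.
- by move=> q qt; apply: sb; rewrite inE qt orbT.
- by move=> q q' qt qt'; apply: sd; rewrite inE ?qt ?qt' orbT.
- exact: path_sorted pst.
- move=> q qt; have pq : p.1 <= q.1 by apply: (allP (order_path_min le1_trans pst)).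
  have [||//|//|qp] := sd p q; rewrite ?mem_head ?inE ?qt ?orbT//.
    by apply: contraNneq pt => ->.
  have [|_ qq _] := sb q; first by rewrite inE qt orbT.
  by have := lt_le_trans qq (le_trans qp pq); rewrite ltxx.
Qed.

(** The infimum is not attained, as [I] is open and 0 is excluded; the supremum may be attained at
    1, whence the half-open hull. *)
Lemma bounded_open_itv_hull (I : set R) : open I -> is_interval I ->
  let J := I `&` `]0, 1] in J !=set0 ->
  exists a b : R, [/\ 0 <= a, a < b, b <= 1, J `<=` `]a, b] & `]a, b[ `<=` J].
Proof.
move=> oI iI J J0; exists (inf J), (sup J).
have Jlb : lbound J 0 by move=> x [_]; rewrite /= in_itv/= => /andP[/ltW].
have Jub : ubound J 1 by move=> x [_]; rewrite /= in_itv/= => /andP[].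
have hl : has_lbound J by exists 0.
have hu : has_ubound J by exists 1.
have JS : J `<=` `]inf J, sup J].
  move=> x Jx; rewrite /= in_itv/= (ub_le_sup hu Jx) andbT lt_neqAle.
  rewrite (ge_inf hl Jx) andbT; apply/eqP => xE.
  have [Ix] := Jx; rewrite /= in_itv/= => /andP[x0 x1].
  have : \forall y \near x, I y /\ 0 < y.
    by apply: filterI; [exact: open_nbhs_nbhs|exact: lt_nbhsr].
  move=> /nbhs_ballP[e /= e0 /(_ (x - e / 2))] [].
    by rewrite /ball/= subKr gtr0_norm ?divr_gt0// ltr_pdivrMr// ltr_pMr// ltr1n.
  move=> Iy y0; have : J (x - e / 2).
    by split => //=; rewrite in_itv/= y0 (le_trans _ x1)// gerBl divr_ge0 ?ltW.
  by move=> /(ge_inf hl); rewrite xE lerBrDr gerDl leNgt divr_gt0.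
split => //.
- exact: lb_le_inf.
- by have [x /JS] := J0; rewrite /= in_itv/= => /andP[]; exact: lt_le_trans.
- exact: ge_sup.
- move=> x; rewrite /= in_itv/= => /andP[/(inf_lt J0)[y [Iy y01] yx] /(sup_gt J0)[z [Iz z01] xz]].
  split; first by apply: iI Iy Iz _ _; rewrite !ltW.
  move: y01 z01; rewrite /= !in_itv/= => /andP[y0 _] /andP[_ z1].
  by rewrite (lt_trans y0 yx) (le_trans (ltW xz)).
Qed.

(** Cover [N] by an open set of measure less than [del] and split it into disjoint open intervals.
    Any finitely many of their traces on []0, 1]] span a chain shorter than [del], so each partial
    sum of their [nu]-measures is at most [e]. *)
Lemma abs_cont_chain_dominates (nu : {measure set (measurableTypeR R) -> \bar R}) G :
  abs_cont_chain G ->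
  (forall a b, 0 <= a -> a <= b -> b <= 1 -> nu `]a, b]%classic = (G b - G a)%:E) ->
  forall N : set R, measurable N -> mu N = 0%E -> nu (N `&` `]0, 1]) = 0%E.
Proof.
move=> acG nuE N mN N0; apply/eqP; rewrite eq_le measure_ge0 andbT.
apply/lee_addgt0Pr => e e0; rewrite add0e.
have [del del0 Gdel] := acG e e0.
have [|U [oU NU UNdel]] := lebesgue_regularity_outer mN _ del0.
  by rewrite [X in (X < _)%E]N0 ltry.
have mU : measurable (U : set (measurableTypeR R)) by exact: open_measurable.
have Udel : (mu U < del%:E)%E.
  apply: le_lt_trans UNdel; rewrite -[U in leLHS](setDKU NU).
  rewrite [leLHS](@measureU0 _ _ _ mu)//; exact: measurableD.
pose I := open_disjoint_itv oU; pose J k := I k `&` `]0, 1].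
have mI k : measurable (I k : set (measurableTypeR R)).
  by apply: open_measurable; exact: open_disjoint_itv_open.
have mJ k : measurable (J k : set (measurableTypeR R)) by exact: measurableI.
have tJ : trivIset setT J.
  apply/trivIsetP => i j _ _ ij; have /trivIsetP := @open_disjoint_itv_trivIset _ _ oU.
  by move=> /(_ i j Logic.I Logic.I ij) h; rewrite /J setIACA -/(I i) h set0I.
apply: (@le_trans _ _ (nu (\bigcup_k J k))).
  apply: le_measure; rewrite ?inE//; [exact: measurableI|exact: bigcup_measurable|].
  by rewrite -setI_bigcupl -open_disjoint_itv_bigcup; exact: setSI.
rewrite measure_semi_bigcup//; last exact: bigcup_measurable.
apply: lime_le; first exact: is_cvg_nneseries.
apply: nearW => n.
have hull k : exists ab : R * R, J k !=set0 ->
    [/\ 0 <= ab.1, ab.1 < ab.2, ab.2 <= 1, J k `<=` `]ab.1, ab.2] & `]ab.1, ab.2[ `<=` J k].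
  have [J0|] := pselect (J k !=set0); last by exists (0, 0).
  have [||a [b abP]] := bounded_open_itv_hull _ _ J0.
  - exact: open_disjoint_itv_open.
  - exact: open_disjoint_itv_is_interval.
  - by exists (a, b).
have [ab abP] := choice hull.
(* Only nonempty traces have meaningful endpoints. *)
pose r := [seq k <- iota 0 n | `[< J k !=set0 >]].
have rP k : k \in r -> J k !=set0 by rewrite mem_filter => /andP[/asboolP].
(* If two hulls overlapped, a midpoint of the overlap would lie in both of the disjoint sets. *)
have sep k l : k \in r -> l \in r -> k != l -> (ab k).1 <= (ab l).1 -> (ab k).2 <= (ab l).1.
  move=> /rP/abP[_ k12 _ _ kJ] /rP/abP[_ l12 _ _ lJ] kl kla; rewrite leNgt; apply/negP => lk.
  have : (ab l).1 < Num.min (ab k).2 (ab l).2 by rewrite lt_min lk.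
  move=> /midf_lt[]; set x := _ / _; rewrite lt_min => lx /andP[xk xl].
  have /trivIsetP/(_ k l Logic.I Logic.I kl) := tJ; rewrite -subset0 => /(_ x); apply.
  by split; [apply: kJ|apply: lJ]; rewrite /= in_itv/= ?xk ?xl ?lx// (le_lt_trans kla).
have abinj : {in r &, injective ab}.
  move=> k l kr lr abkl; apply/eqP; apply: contraT => kl.
  have := sep _ _ kr lr kl; rewrite abkl lexx => /(_ erefl).
  by rewrite leNgt; have [_ ->] := abP _ (rP _ lr).
have [|||s' ss' cs'] := disjoint_itvs_chain (s := map ab r).
- by rewrite map_inj_in_uniq// filter_uniq// iota_uniq.
- by move=> _ /mapP[k /rP/abP[? ? ? _ _] ->].
- move=> _ _ /mapP[k kr ->] /mapP[l lr ->] abkl.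
  have kl : k != l by apply: contraNneq abkl => ->.
  have [h|/ltW h] := leP (ab k).1 (ab l).1; [left|right]; apply: sep => //.
  by rewrite eq_sym.
have nuJ : (\sum_(0 <= k < n) nu (J k) = \sum_(k <- r) nu (J k))%E.
  rewrite big_filter /index_iota subn0 [LHS](bigID (fun k => `[< J k !=set0 >]))/=.
  rewrite [X in (_ + X)%E]big1 ?adde0// => k /asboolPn/set0P/negP; rewrite negbK => /eqP ->.
  by rewrite measure0.
have muJ : (\sum_(k <- r) mu (J k) <= mu U)%E.
  apply: (@le_trans _ _ (\sum_(0 <= k < n) mu (J k))%E).
    by rewrite big_filter /index_iota subn0; apply: lee_sum_nneg_subset.
  apply: (@le_trans _ _ (mu (\bigcup_k J k))).
    rewrite measure_semi_bigcup//; last exact: bigcup_measurable.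
    exact: nneseries_lim_ge.
  apply: le_measure; rewrite ?inE//; first exact: bigcup_measurable.
  by rewrite [X in _ `<=` X](open_disjoint_itv_bigcup oU) -setI_bigcupl; exact: subIsetl.
rewrite nuJ; apply: (@le_trans _ _ (chain_var G s')%:E); last first.
  rewrite lee_fin ltW// Gdel// -lte_fin; apply: le_lt_trans Udel.
  apply: le_trans muJ; rewrite /chain_length -(perm_big _ ss')/= big_map -sumEFin.
  rewrite big_seq [leRHS]big_seq; apply: lee_sum => k /rP/abP[_ k12 _ _ kJ].
  (* Lengths are bounded through the open interval inside [J k], [nu]-measures below through the
     half-open one around it. *)
  apply: (@le_trans _ _ (mu `](ab k).1, (ab k).2[)).
    by rewrite lebesgue_measure_itv/= lte_fin k12.
  by apply: le_measure; rewrite ?inE//.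
rewrite /chain_var -(perm_big _ ss')/= big_map -sumEFin.
rewrite big_seq [leRHS]big_seq; apply: lee_sum => k /rP/abP[k0 k12 k1 kJ _].
apply: (@le_trans _ _ (nu `](ab k).1, (ab k).2]%classic)).
  by apply: le_measure; rewrite ?inE//.
by rewrite (nuE _ _ k0 (ltW k12) k1) lee_fin ler_norm.
Qed.

(** The density is the Radon-Nikodym derivative of the Stieltjes measure of [F \o clamp], restricted
    to []0, 1]] to be finite and dominated. *)
Lemma nondecreasing_abs_cont_density F : abs_cont_chain F ->
  (forall x y, 0 <= x -> x <= y -> y <= 1 -> F x <= F y) ->
  exists g, has_density F g.
Proof.
move=> acF ndF; pose G := F \o clamp.
have ndG : {homo G : x y / x <= y}.
  move=> x y xy; have /andP[x0 _] := clamp_bounds x; have /andP[_ y1] := clamp_bounds y.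
  by apply: ndF => //; exact: clamp_homo.
have rcG : right_continuous G by apply/right_continuousW/clamp_continuous.
pose Gc : cumulative R R := HB.pack G (@isCumulative.Build R _ R G ndG rcG).
pose nu : {measure set (measurableTypeR R) -> \bar R} := lebesgue_stieltjes_measure Gc.
have nuE a b : 0 <= a -> a <= b -> b <= 1 -> nu `]a, b]%classic = (F b - F a)%:E.
  move=> a0 ab b1; transitivity (wlength Gc `]a, b]%classic).
    exact: (measurable_mu_extE (wlength Gc) (is_ocitv a b)).
  by rewrite wlength_itv_bnd//= /G/= !clamp_id ?a0 ?b1 ?(le_trans a0 ab) ?(le_trans ab b1).
have m01 : measurable (`]0%R, 1%R]%classic : set (measurableTypeR R)) by exact: measurable_itv.
have nu01 : (nu `]0%R, 1%R]%classic < +oo)%E by rewrite nuE// ltry.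
pose nu' : {finite_measure set (measurableTypeR R) -> \bar R} := mfrestr m01 nu01.
have dom : nu' `<< mu.
  apply/null_content_dominatesP => N mN N0.
  exact: (abs_cont_chain_dominates acF nuE mN N0).
have [g [g0 gfin gint gE]] := radon_nikodym_sigma_finite dom.
have gEF : EFin \o (fine \o g) = g by apply/funext => x /=; rewrite fineK.
exists (fine \o g); split; first by rewrite gEF.
move=> x /andP[x0 x1].
have mx (i : interval R) : measurable ([set` i] : set (measurableTypeR R)) by exact: measurable_itv.
rewrite -Rintegral_itv_obnd_cbnd; last first.
  by rewrite gEF; apply: integrableS gint => //; exact: mx.
apply: EFin_inj; rewrite -(nuE _ _ (lexx 0) x0 x1) /Rintegral.
have -> : (\int[mu]_(t in `]0%R, x]) ((fine \o g) t)%:E = \int[mu]_(t in `]0%R, x]) g t)%E.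
  by apply: eq_integral => t _; rewrite /= fineK.
rewrite -gE; last exact: mx.
rewrite /= /mfrestr /mrestr setIidl ?fineK//.
  by rewrite ge0_fin_numE// nuE// ltry.
by apply: subset_itvl; rewrite bnd_simp.
Qed.

Lemma has_densityB f F g G :
  has_density f g -> has_density F G ->
  has_density (fun x => f x - F x) (fun x => g x - G x).
Proof.
move=> [ig gE] [iG GE]; split.
  rewrite (_ : EFin \o _ = (EFin \o g) \- (EFin \o G))%E; first exact: integrableB.
  by apply/funext.
move=> x x01; rewrite RintegralB// -?gE -?GE//; first by ring.
- exact: integrableS ig.
- exact: integrableS iG.
Qed.

Lemma abs_cont_density f : abs_cont_chain f -> exists g, has_density f g.
Proof.
move=> /abs_cont_chain_jordan[F [G [[acF acG] ndF ndG ->]]].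
have [g1 d1] := nondecreasing_abs_cont_density acF ndF.
have [g2 d2] := nondecreasing_abs_cont_density acG ndG.
by exists (fun x => g1 x - g2 x); exact: has_densityB.
Qed.

(** At a Lebesgue point of [g] the indefinite integral [H] has derivative [g x]; [f] agrees with
    [f 0 + H] around interior points of [[0, 1]]. *)
Lemma has_density_derive f g : has_density f g ->
  {ae mu, forall x : R, 0 < x < 1 -> is_derive x (1 : R) f (g x)}.
Proof.
move=> [ig gE]; pose H y := \int[mu]_(t in `[0, y]) g t.
have : {ae mu, forall x, lebesgue_pt g x}.
  apply: lebesgue_differentiation.
  by rewrite -[g](patch_setT (fun=> 0)); exact: integrable_locally ig.
apply: filterS; first exact: (ae_filter_ringOfSetsType mu).
move=> x gx /andP[x0 x1].
have [||dH HE] := FTC1_lebesgue_pt x1 _ _ gx (a := BLeft 0).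
- exact: integrableS ig.
- by rewrite /= lte_fin.
have Hx : is_derive x 1 H (g x) by apply: DeriveDef => //; rewrite -derive1E.
apply: (@near_eq_is_derive _ _ _ (fun y => f 0 + H y)) => //.
- near=> y; rewrite /H -gE ?subrKC//.
  apply/andP; split; apply: ltW; near: y; [exact: lt_nbhsr|exact: lt_nbhsl].
- by rewrite -[g x]add0r; apply: is_deriveD.
Unshelve. all: by end_near. Qed.

End density.

(** * Null sets and integrals of arbitrary functions *)

Section ae_eq_integral_nonmeasurable.
Local Open Scope ereal_scope.
Context (dp : measure_display) (T : measurableType dp) (R : realType).
Variable mu : {measure set T -> \bar R}.
Import HBNNSimple.

(* No measurability of [f] and [g]: a simple function below [f] is brought below
   [g] by cutting it off on a null set, which does not change its integral. *)
Lemma ge0_le_integral_null (f g : T -> \bar R) (N : set T) :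
  measurable N -> mu N = 0 -> (forall x, 0 <= f x) -> (forall x, 0 <= g x) ->
  (forall x, ~ N x -> f x = g x) ->
  \int[mu]_x f x <= \int[mu]_x g x.
Proof.
move=> mN N0 f0 g0 fg; rewrite !ge0_integralTE//.
apply: ge_ereal_sup => _ [h /= hf <-].
pose h' := mul_nnsfun h (indic_nnsfun R (measurableC mN)).
have h'E x : h' x = (h x * \1_(~` N) x)%R by [].
rewrite (_ : sintegral mu h = sintegral mu h'); last first.
  rewrite -!integralT_nnsfun; apply: ge0_ae_eq_integral => //.
  - exact/measurable_EFinP.
  - exact/measurable_EFinP.
  - by move=> x _; rewrite lee_fin.
  - by move=> x _; rewrite lee_fin.
  - exists N; split => // x /= hx; apply: contrapT => Nx; apply: hx => _.
    by rewrite [RHS](congr1 EFin (h'E x)) indicE mem_set//= mulr1.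
apply: ereal_sup_ubound; exists h' => //= x.
rewrite [leLHS](congr1 EFin (h'E x)) indicE; have [Nx|Nx] := pselect (N x).
  by rewrite memNset ?mulr0//= => /(_ Nx).
by rewrite mem_set//= mulr1 -fg.
Qed.

(** The preceding inequality, used both ways on positive and negative parts. It lets [derive1] be
    replaced by a density under the integral sign without a measurability proof. *)
Lemma ae_eq_integralW (D : set T) (f g : T -> \bar R) :
  ae_eq mu D f g -> \int[mu]_(x in D) f x = \int[mu]_(x in D) g x.
Proof.
move=> [N [mN N0 fgN]].
have fg x : ~ N x -> (f \_ D) x = (g \_ D) x.
  move=> Nx; rewrite !patchE; case: ifPn => // /set_mem Dx.
  by apply: contrapT => fgx; apply/Nx/fgN => /(_ Dx).
have E (u v : T -> \bar R) : (forall x, 0 <= u x) -> (forall x, 0 <= v x) ->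
    (forall x, ~ N x -> u x = v x) -> \int[mu]_x u x = \int[mu]_x v x.
  move=> u0 v0 uv; apply/eqP; rewrite eq_le.
  rewrite (ge0_le_integral_null mN N0 u0 v0 uv)/= (ge0_le_integral_null mN N0 v0 u0)//.
  by move=> x /uv.
rewrite integral_mkcond [RHS]integral_mkcond integralE [RHS]integralE.
by congr (_ - _); apply: E => // x /fg fgx; rewrite ?funeposE ?funenegE fgx.
Qed.

End ae_eq_integral_nonmeasurable.

(** * Signatures *)

Section density_signature.
Variables (R : realType) (d : nat).
Local Notation mu := (@lebesgue_measure R).
Implicit Types (g : 'I_d -> R -> R) (Z : rpath R d) (A : 'M[R]_d) (rw : seq 'I_d).

Lemma Rintegral_lincomb (I : Type) (r : seq I) (a : I -> R) (F : I -> R -> R)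
    (D : set R) : measurable D -> (forall i, mu.-integrable D (EFin \o F i)) ->
  mu.-integrable D (EFin \o (fun s => \sum_(i <- r) a i * F i s)) /\
  \int[mu]_(s in D) (\sum_(i <- r) a i * F i s) =
    \sum_(i <- r) a i * \int[mu]_(s in D) F i s.
Proof.
move=> mD iF; elim: r => [|i r [iIH IH]].
  split; first by rewrite (_ : _ \o _ = cst 0%E) ?integrable0//; apply/funext => s /=; rewrite big_nil.
  by rewrite big_nil; under eq_Rintegral do rewrite big_nil; rewrite Rintegral_cst//= mul0r.
have ia : mu.-integrable D (EFin \o (fun s => a i * F i s)).
  by rewrite (_ : _ \o _ = (fun s => (a i)%:E * (EFin \o F i) s)%E); [exact: integrableZl|apply/funext].
split.
  rewrite (_ : _ \o _ = (EFin \o (fun s => a i * F i s)%R) \+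
    (EFin \o (fun s => \sum_(i <- r) a i * F i s)%R))%E; first exact: integrableD.
  by apply/funext => s /=; rewrite big_cons.
rewrite big_cons -IH -RintegralZl// -RintegralD//.
by apply: eq_Rintegral => s _; rewrite big_cons.
Qed.

Lemma continuous01_bounded (f : R -> R) : {within `[0, 1], continuous f} ->
  exists K, forall x, 0 <= x <= 1 -> `|f x| <= K.
Proof.
move=> cf; have [c _ fc] := EVT_max ler01 cf; have [b _ fb] := EVT_min ler01 cf.
exists (`|f c| + `|f b|) => x x01.
have fx : - `|f b| <= f x <= `|f c|.
  rewrite (le_trans (fc _ _) (ler_norm _)) ?in_itv// andbT.
  by rewrite (le_trans _ (fb _ _)) ?in_itv// lerNl -normrN ler_norm.
by have := normr_ge0 (f c); have := normr_ge0 (f b); rewrite ler_norml; lra.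
Qed.

Lemma integrableM01 (f h : R -> R) (t : R) : 0 <= t <= 1 ->
  {within `[0, 1], continuous f} -> mu.-integrable setT (EFin \o h) ->
  mu.-integrable `[0, t] (EFin \o (fun s => f s * h s)).
Proof.
move=> /andP[t0 t1] cf ih; have m01 : measurable (`[0%R, 1%R]%classic : set R)
  by exact: measurable_itv.
have : mu.-integrable `[0, 1] ((EFin \o f) \* (EFin \o h))%E.
  apply: integrableMr => //.
  - exact: subspace_continuous_measurable_fun.
  - have [K fK] := continuous01_bounded cf.
    exists K; split; first by rewrite num_real.
    by move=> M KM x /=; rewrite in_itv/= => /fK fxK; exact: le_trans (ltW KM).
  - exact: integrableS ih.
apply: integrableS => // x /=; rewrite !in_itv/= => /andP[-> xt].
exact: le_trans t1.
Qed.

(** [sig_rev] with integrable densities in place of the derivatives; words are reversed here too. *)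
Fixpoint dsig g rw (t : R) : R :=
  if rw is i :: rw' then \int[mu]_(s in `[0, t]) (dsig g rw' s * g i s) else 1.

Lemma dsig_continuous g rw : (forall i, mu.-integrable setT (EFin \o g i)) ->
  {within `[0, 1], continuous (dsig g rw)}.
Proof.
move=> ig; elim: rw => [|i rw IHrw] /=; first by apply: continuous_subspaceT => x; exact: cvg_cst.
apply: (@parameterized_integral_continuous _ 0 1) => //.
by apply: integrableM01 => //; rewrite ler01 lexx.
Qed.

Lemma dsig_integrable g rw i (t : R) : (forall i, mu.-integrable setT (EFin \o g i)) ->
  0 <= t <= 1 -> mu.-integrable `[0, t] (EFin \o (fun s => dsig g rw s * g i s)).
Proof. by move=> ig t01; apply: integrableM01 => //; exact: dsig_continuous. Qed.

Lemma ae_in_oo01 : {ae mu, forall x : R, 0 <= x <= 1 -> 0 < x < 1}.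
Proof.
exists [set 0; 1]; split => //.
- exact: measurableU.
- by rewrite [LHS](@measureU0 _ _ _ mu)//; exact: lebesgue_measure_set1.
- move=> x /= /not_implyP[/andP[x0 x1] /negP]; rewrite !lt_neqAle x0 x1 !andbT negb_and !negbK.
  by move=> /orP[/eqP <-|/eqP ->]; [left|right].
Qed.

Lemma ae_eq_Rintegral01 (f h : R -> R) (t : R) : 0 <= t <= 1 ->
  {ae mu, forall x : R, 0 < x < 1 -> f x = h x} ->
  \int[mu]_(s in `[0, t]) f s = \int[mu]_(s in `[0, t]) h s.
Proof.
move=> /andP[t0 t1] fh; congr fine; apply: ae_eq_integralW.
apply: (filterS2 _ _ fh ae_in_oo01); first exact: (ae_filter_ringOfSetsType mu).
move=> x fhx x01 /=; rewrite in_itv/= => /andP[x0 xt]; congr EFin.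
by apply/fhx/x01; rewrite x0 (le_trans xt).
Qed.

Lemma sig_rev_density Z g rw (t : R) : (forall i, has_density (Defs.coord Z i) (g i)) ->
  0 <= t <= 1 -> sig_rev Z rw t = dsig g rw t.
Proof.
move=> Zg; elim: rw t => //= i rw IHrw t /andP[t0 t1].
transitivity (\int[mu]_(s in `[0, t]) (dsig g rw s * derive1 (Defs.coord Z i) s)).
  apply: eq_Rintegral => s; rewrite inE/= in_itv/= => /andP[s0 st].
  by rewrite IHrw// s0 (le_trans st).
apply: ae_eq_Rintegral01; first by rewrite t0.
apply: filterS (has_density_derive (Zg i)); first exact: (ae_filter_ringOfSetsType mu).
by move=> x Zx /Zx h; rewrite derive1E derive_val.
Qed.

(** Coefficient at [rw] of a tensor power of [A] applied to the tensor [f], as nested sums that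
    follow the recursion of [sig_rev]. *)
Fixpoint tens A rw (f : seq 'I_d -> R) : R :=
  if rw is i :: rw' then \sum_j A i j * tens A rw' (fun u => f (j :: u)) else f [::].

Lemma tensMr A rw f c : tens A rw f * c = tens A rw (fun u => f u * c).
Proof.
elim: rw f => //= i rw IHrw f; rewrite mulr_suml; apply: eq_bigr => j _.
by rewrite -mulrA IHrw.
Qed.

(** Integrability is part of the conclusion because linearity at the next letter uses it. *)
Lemma Rintegral_tens A rw (F : seq 'I_d -> R -> R) (D : set R) : measurable D ->
  (forall u, mu.-integrable D (EFin \o F u)) ->
  mu.-integrable D (EFin \o (fun s => tens A rw (F^~ s))) /\
  \int[mu]_(s in D) tens A rw (F^~ s) = tens A rw (fun u => \int[mu]_(s in D) F u s).
Proof.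
move=> mD; elim: rw F => [|i rw IHrw] F iF //=.
have h j := IHrw (fun u => F (j :: u)) (fun u => iF (j :: u)).
have [iL ->] := Rintegral_lincomb (index_enum 'I_d) (A i)
  (F := fun j s => tens A rw (fun u => F (j :: u) s)) mD (fun j => (h j).1).
by split => //; apply: eq_bigr => j _; rewrite (h j).2.
Qed.

Lemma has_density_act A Z g : (forall i, has_density (Defs.coord Z i) (g i)) ->
  forall i, has_density (Defs.coord (act_path A Z) i) (fun s => \sum_j A i j * g j s).
Proof.
move=> Zg i; split.
  by have [] := Rintegral_lincomb (index_enum 'I_d) (A i) measurableT (fun j => (Zg j).1).
move=> x x01.
have [|_ ->] := @Rintegral_lincomb _ (index_enum 'I_d) (A i) g `[0, x]%classic (measurable_itv _).
  by move=> j; apply: integrableS (Zg j).1 => //; exact: measurable_itv.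
rewrite /Defs.coord /act_path !mxE -sumrB; apply: eq_bigr => j _.
by rewrite -mulrBr -(Zg j).2.
Qed.

Lemma dsig_act A g rw (t : R) : (forall i, mu.-integrable setT (EFin \o g i)) ->
  0 <= t <= 1 ->
  dsig (fun i s => \sum_j A i j * g j s) rw t = tens A rw (fun u => dsig g u t).
Proof.
move=> ig; elim: rw t => //= i rw IHrw t t01.
(* The value at the empty word is a filler that keeps every [F v] integrable; [tens A (i :: rw)]
   never reads it. *)
pose F (v : seq 'I_d) s := if v is j :: u then dsig g u s * g j s else 0.
have [|_ /= <-] := @Rintegral_tens A (i :: rw) F `[0, t]%classic (measurable_itv _).
  case=> [|j u]; last exact: dsig_integrable.
  by rewrite (_ : _ \o _ = cst 0%E) ?integrable0//; exact: measurable_itv.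
apply: eq_Rintegral => s; rewrite inE/= in_itv/= => /andP[s0 st].
rewrite IHrw; last by case/andP: t01 => _; rewrite s0; exact: le_trans.
rewrite mulr_sumr; apply: eq_bigr => j _; rewrite mulrCA; congr (_ * _).
by rewrite tensMr.
Qed.

(** Used in place of absolute continuity since it passes to [act_path A Z] by linearity of the
    integral. *)
Definition has_path_density Z := exists g, forall i, has_density (Defs.coord Z i) (g i).

Lemma abs_cont_path_density Z : abs_cont_path Z -> has_path_density Z.
Proof.
move=> acZ; have h i : exists gi, has_density (Defs.coord Z i) gi.
  exact/abs_cont_density/abs_cont01_chain.
by have [g Zg] := choice h; exists g.
Qed.

Lemma act_path_density A Z : has_path_density Z -> has_path_density (act_path A Z).
Proof.
by move=> [g Zg]; exists (fun i s => \sum_j A i j * g j s); exact: has_density_act.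
Qed.

Lemma sig_rev_act A Z rw : has_path_density Z ->
  sig_rev (act_path A Z) rw 1 = tens A rw (fun u => sig_rev Z u 1).
Proof.
move=> [g Zg]; have t1 : 0 <= (1 : R) <= 1 by rewrite ler01 lexx.
rewrite (sig_rev_density _ (has_density_act A Zg))// dsig_act// => [|i]; last by have [] := Zg i.
by congr tens; apply/funext => u; rewrite (sig_rev_density _ Zg).
Qed.

Lemma signature_act_congr A Z Zt : has_path_density Z -> has_path_density Zt ->
  signature Z = signature Zt -> signature (act_path A Z) = signature (act_path A Zt).
Proof.
move=> dZ dZt SE; apply/funext => w; rewrite /signature !sig_rev_act//.
by congr tens; apply/funext => u; have := congr1 (fun S => S (rev u)) SE; rewrite /signature revK.
Qed.

(** Integration by parts: the product of two coordinate increments is absolutely continuous, and its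
    density is almost everywhere given by the Leibniz rule. *)
Lemma signature_shuffle2 Z i j : abs_cont_path Z ->
  signature Z [:: i; j] + signature Z [:: j; i] = signature Z [:: i] * signature Z [:: j].
Proof.
move=> acZ; have [g Zg] := abs_cont_path_density acZ.
have ig k : mu.-integrable setT (EFin \o g k) by have [] := Zg k.
have t1 : 0 <= (1 : R) <= 1 by rewrite ler01 lexx.
rewrite /signature !(sig_rev_density _ Zg)//.
rewrite -[rev [:: i; j]]/[:: j; i] -[rev [:: j; i]]/[:: i; j].
rewrite -[rev [:: i]]/[:: i] -[rev [:: j]]/[:: j].
pose f k x := Defs.coord Z k x - Defs.coord Z k 0.
have dsig1 k x : 0 <= x <= 1 -> dsig g [:: k] x = f k x.
  move=> x01; rewrite /f (Zg k).2//=; apply: eq_Rintegral => s _; exact: mul1r.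
have cstAC (c : R) : abs_cont_chain (fun=> c).
  move=> e e0; exists 1 => // s _ _; rewrite /chain_var big1 // => p _.
  by rewrite subrr normr0.
have fAC k : abs_cont_chain (f k).
  by apply: abs_cont_chainB => //; exact/abs_cont01_chain.
(* The factors are bounded because they agree on [[0, 1]] with continuous functions;
   [abs_cont_chainM] asks for this. *)
have [Ki fKi] := continuous01_bounded (dsig_continuous (rw := [:: i]) ig).
have [Kj fKj] := continuous01_bounded (dsig_continuous (rw := [:: j]) ig).
have [k [ik kE]] : exists k, has_density (fun x => f i x * f j x) k.
  apply: abs_cont_density; apply: (@abs_cont_chainM _ _ _ (Num.max Ki Kj)) => // x x01.
    by rewrite -dsig1// le_max fKi.
  by rewrite -dsig1// le_max fKj ?orbT.
have fder l : {ae mu, forall x : R, 0 < x < 1 -> is_derive x (1 : R) (f l) (g l x)}.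
  apply: filterS (has_density_derive (Zg l)); first exact: (ae_filter_ringOfSetsType mu).
  move=> x Zx /Zx h; rewrite -[g l x]subr0; exact: is_deriveB.
have := kE 1 t1; rewrite [f i 0]subrr mul0r subr0 -!dsig1// => ->.
have -> : \int[mu]_(s in `[0, 1]) k s =
    \int[mu]_(s in `[0, 1]) (dsig g [:: i] s * g j s + dsig g [:: j] s * g i s).
  apply: ae_eq_Rintegral01 => //.
  have hk := has_density_derive (conj ik kE).
  apply: (filterS3 _ _ hk (fder i) (fder j)); first exact: (ae_filter_ringOfSetsType mu).
  move=> x hx fi fj x01; have x01' : 0 <= x <= 1 by case/andP: x01 => /ltW-> /ltW->.
  rewrite !dsig1//; have <- := @derive_val _ _ _ _ _ _ _ (hx x01).
  have := is_deriveM (fi x01) (fj x01) => h.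
  by have -> := @derive_val _ _ _ _ _ _ _ h.
by rewrite RintegralD//; exact: dsig_integrable.
Qed.

Lemma act_pathM A B Z : act_path A (act_path B Z) = act_path (A *m B) Z.
Proof. by apply/funext => t; rewrite /act_path mulmxA. Qed.

Lemma act_path1 Z : act_path 1%:M Z = Z.
Proof. by apply/funext => t; rewrite /act_path mul1mx. Qed.

(** Removes the case distinction on [i < j], which does not commute with matrix products. *)
Lemma c_le2_skew Z : (forall i j, logsig2 Z i j = - logsig2 Z j i) ->
  (c_le2 Z).2 = \matrix_(i, j) logsig2 Z i j.
Proof.
move=> skew; apply/matrixP => i j; rewrite !mxE.
case: ltngtP => [//|ji|/val_inj ij]; first by rewrite [RHS]skew.
by have := skew i i; rewrite ij; lra.
Qed.

Lemma logsig2_skew Z i j : abs_cont_path Z -> logsig2 Z i j = - logsig2 Z j i.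
Proof.
move=> acZ; have := signature_shuffle2 i j acZ; rewrite /logsig2.
move: (signature _ [:: i; j]) (signature _ [:: j; i]) => a b.
by move: (signature _ [:: i]) (signature _ [:: j]) => x y; lra.
Qed.

Lemma c_le2_act A Z : abs_cont_path Z -> c_le2 (act_path A Z) = act A (c_le2 Z).
Proof.
move=> acZ; have dZ := abs_cont_path_density acZ.
have S1 i : signature (act_path A Z) [:: i] = \sum_j A i j * signature Z [:: j].
  by rewrite /signature sig_rev_act.
have S2 i j : signature (act_path A Z) [:: i; j] =
    \sum_l \sum_k A i l * signature Z [:: l; k] * A j k.
  rewrite [LHS]sig_rev_act//; pose S u := sig_rev Z u 1.
  (* [S] reads reversed words, so [tens] expands the letter [j] first. *)
  change (tens A [:: j; i] S = \sum_l \sum_k A i l * S [:: k; l] * A j k).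
  rewrite exchange_big/=; apply: eq_bigr => k _.
  by rewrite mulr_sumr; apply: eq_bigr => l _; rewrite mulrC.
have L2 i j : logsig2 (act_path A Z) i j =
    \sum_l \sum_k A i l * logsig2 Z l k * A j k.
  rewrite /logsig2 S2 !S1; move: (signature Z) => S; rewrite mulr_suml mulr_sumr -sumrB; apply: eq_bigr => l _.
  rewrite !mulr_sumr -sumrB; apply: eq_bigr => k _; ring.
have skewZ k l : logsig2 Z k l = - logsig2 Z l k by exact: logsig2_skew.
(* Skewness passes to the image path through the congruence formula [L2]. *)
have skewA i j : logsig2 (act_path A Z) i j = - logsig2 (act_path A Z) j i.
  move: skewZ L2; move: (logsig2 Z) (logsig2 _) => L LA skewL LE.
  rewrite !LE exchange_big/= -sumrN; apply: eq_bigr => k _.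
  rewrite -sumrN; apply: eq_bigr => l _; rewrite (skewL l k); ring.
rewrite [LHS]surjective_pairing; congr pair.
  apply/matrixP => i j; rewrite !mxE [LHS]S1.
  by apply: eq_bigr => k _; rewrite [(\col__ _) _ _]mxE.
apply: etrans (c_le2_skew skewA) _; rewrite (c_le2_skew skewZ).
move: L2; move: (logsig2 Z) (logsig2 _) => L LA LE.
apply/matrixP => i j; rewrite !mxE LE exchange_big/=; apply: eq_bigr => k _.
by rewrite !mxE mulr_suml; apply: eq_bigr => l _; rewrite !mxE.
Qed.

Lemma c_le2_signature Z Zt : signature Z = signature Zt -> c_le2 Z = c_le2 Zt.
Proof. by rewrite /c_le2 /logsig1 /logsig2; case: _ /. Qed.

End density_signature.

Theorem theorem4p5 (R : realType) (d : nat) (Z Zt : rpath R d) :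
  (2 <= d)%N ->
  abs_cont_path Z -> abs_cont_path Zt ->
  U_set (c_le2 Z) -> U_set (c_le2 Zt) ->
  (signature (act_path (rho (c_le2 Z)) Z) = signature (act_path (rho (c_le2 Zt)) Zt)
   <-> exists g : 'M[R]_d, orthogonal_mx g /\ signature (act_path g Z) = signature Zt).
Proof.
move=> _ acZ acZt UZ UZt.
have dZ := abs_cont_path_density acZ; have dZt := abs_cont_path_density acZt.
have [oZ _] := rhoP UZ; have [oZt _] := rhoP UZt.
split=> [SE|[g [og SE]]].
  (* Applying the inverse frame of [Zt] to both sides of [SE] recovers [Zt] on the right. *)
  exists ((rho (c_le2 Zt))^T *m rho (c_le2 Z)); split.
    by apply: orthogonal_mxM => //; exact: orthogonal_mx_tr.
  rewrite -act_pathM (signature_act_congr _ _ _ SE); [|exact: act_path_density..].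
  by rewrite act_pathM (mulmx1C oZt) act_path1.
have cE := etrans (c_le2_signature (esym SE)) (c_le2_act g acZ).
have rhoE c : c = act g (c_le2 Z) -> U_set c -> rho c *m g = rho (c_le2 Z).
  by move=> ->; exact: rho_act.
(* The frame of [Z] is that of [Zt] times [g], so both sides are the frame of [Zt] applied to paths
   of equal signature. *)
apply: etrans (congr1 (fun h => signature (act_path h Z)) (esym (rhoE _ cE UZt))) _.
rewrite -act_pathM; apply: signature_act_congr SE => //.
exact: act_path_density.
Qed.
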